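(* Let $R$ be a random variable with $R > 0$ and let $\Theta$ be independent of $R$ and uniformly distributed on $(-\pi, \pi)$. For $\rho \in [-1, 1]$ let $C_\rho$ be the bivariate elliptical copula with correlation parameter $\rho$ and radius $R$, and let $\lambda_\rho(u) = u^{-1} \, C_\rho(u, u)$ for $0 < u \le 1$. Then for every $u \in (0, 1/2]$, the function $\rho \mapsto \lambda_\rho(u)$ is convex in $\rho \in [0, 1]$.
   Context: The elliptical copula $C_\rho$ is defined as follows. Put $(S_1, S_2) = (R \cos \Theta, R \sin \Theta)$ and, for $-1 \le \rho \le 1$, let $(X, Y) = \bigl(S_1, \, \rho S_1 + (1 - \rho^2)^{1/2} S_2\bigr)$. The variables $X$, $Y$, $S_1$, $S_2$ have a common distribution function $F$, not depending on $\rho$. Then $C_\rho(u, v) = \Pr(U \le u, V \le v)$ for $(u, v) \in [0, 1]^2$, where $U = F(X)$ and $V = F(Y)$. The distribution of $R$ is fixed, and $C_\rho$ is viewed as a family parameterized by $\rho$. The quantity $\lambda_\rho(u) = u^{-1} C_\rho(u,u) = \Pr(U < u \mid V < u)$ is called the coefficient of penultimate tail dependence. *)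

(* Defs.v *)
From HB Require Import structures.
From mathcomp Require Import all_boot all_order all_algebra.
From mathcomp Require Import all_classical all_reals all_analysis.
From mathcomp Require Import measurable_realfun.

Set Implicit Arguments.
Unset Strict Implicit.
Unset Printing Implicit Defensive.

Import Order.TTheory GRing.Theory Num.Theory.
Import numFieldNormedType.Exports.

Local Open Scope classical_set_scope.
Local Open Scope ring_scope.

Lemma ltNpipi (R : realType) : - pi < pi :> R.
Proof. by rewrite gtrN ?pi_gt0. Qed.

(* The uniform law on the closed interval [-pi, pi]; as a measure it is the
   uniform law on the open interval, endpoints being Lebesgue-null. Equality is
   only required on measurable sets, outside of which the values of measures
   are junk. *)
Definition uniform_angle d (T : measurableType d) (R : realType)
    (P : probability T R) (Theta : {RV P >-> R}) : Prop :=
  forall A : set R, measurable A ->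
    distribution P Theta A = uniform_prob (ltNpipi R) A.

Definition independent_RV d (T : measurableType d) (R : realType)
    (P : probability T R) (X Y : {RV P >-> R}) : Prop :=
  forall A B : set R, measurable A -> measurable B ->
    P (X @^-1` A `&` Y @^-1` B) = (P (X @^-1` A) * P (Y @^-1` B))%E.

Section elliptical_copula.
Context d (T : measurableType d) (R : realType) (P : probability T R).
Variables Rad Theta : {RV P >-> R}.
Implicit Types rho u v : R.

Definition S1 (w : T) : R := Rad w * cos (Theta w).
Definition S2 (w : T) : R := Rad w * sin (Theta w).

Lemma measurable_S1 : measurable_fun [set: T] S1.
Proof.
apply: measurable_funM => //; apply: measurableT_comp => //.
by apply: continuous_measurable_fun; exact: continuous_cos.
Qed.

HB.instance Definition _ := isMeasurableFun.Build _ _ _ _ S1 measurable_S1.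

Definition ellX : T -> R := S1.

(* Meaningful for -1 <= rho <= 1: Num.sqrt is 0 on negative reals. *)
Definition ellY rho (w : T) : R := rho * S1 w + Num.sqrt (1 - rho ^+ 2) * S2 w.

(* The distribution function common to S1, S2, ellX and ellY rho, when Theta is
   uniform and independent of Rad. *)
Definition ellF (x : R) : R := fine (cdf (S1 : {RV P >-> R}) x).

Definition ellU (w : T) : R := ellF (ellX w).
Definition ellV rho (w : T) : R := ellF (ellY rho w).

Definition elliptical_copula rho u v : R :=
  fine (P [set w | ellU w <= u /\ ellV rho w <= v]).

Definition penultimate_tail_dependence rho u : R :=
  u^-1 * elliptical_copula rho u u.

End elliptical_copula.

(* Main.v *)
(* Since F > 1/2 on the positive reals, {F <= u} is a half-line below some
   x <= 0. Write rho = cos alpha, so that Y = R cos (Theta - alpha). Given R = r,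
   the events X <= x and Y <= x are that Theta lies in two arcs of half-width
   a = acos (- x / r) <= pi / 2 (empty if r < - x), centred at pi and pi + alpha;
   their intersection has length max (0, 2 a - acos rho), which is convex in rho
   because acos is concave on [0, 1]. Integrating over the law of R preserves
   convexity. *)
Require Import Defs.
From HB Require Import structures.
From mathcomp Require Import all_boot all_order all_algebra.
From mathcomp Require Import all_classical all_reals all_analysis.
From mathcomp Require Import measurable_realfun ring lra.

Set Implicit Arguments.
Unset Strict Implicit.
Unset Printing Implicit Defensive.

Import Order.TTheory GRing.Theory Num.Theory.
Import numFieldNormedType.Exports.

Local Open Scope classical_set_scope.
Local Open Scope ring_scope.

(** * Concavity of [cos] and [acos] *)

Lemma cos_concave (R : realType) (t : {i01 R}) (a b : R) :
    0 <= a <= pi / 2 -> 0 <= b <= pi / 2 ->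
  t%:num * cos a + (1 - t%:num) * cos b <= cos (t%:num * a + (1 - t%:num) * b).
Proof.
(* The second-derivative criterion wants ordered endpoints; exchanging [a] and [b] turns [t] into
   [1 - t]. *)
wlog ab : t a b / a <= b => [hwlog ha hb|].
  have [ab|/ltW ba] := leP a b; first exact: hwlog.
  have := hwlog (1 - t%:num)%:i01 b a ba hb ha.
  by rewrite /= subKr [leLHS]addrC [X in _ <= cos X]addrC; exact.
move=> /andP[a0 _] /andP[_ bpi].
have dN (x : R) : is_derive x (1:R) (fun x : R => - cos x : R^o) (sin x).
  by apply: is_derive_eq; rewrite opprK.
have D : 'D_1 (fun x : R => - cos x : R^o) = @sin R.
  by apply/funext => x; rewrite derive_val.
have cN (x : R) : (fun x : R => - cos x : R^o) z @[z --> x] --> - cos x.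
  by apply: cvgN; exact: continuous_cos.
have := @second_derivative_convex R (fun x : R => - cos x : R^o) a b
  _ _ _ _ _ t ab.
rewrite /conv/= => H.
suff : - cos (t%:num * a + (1 - t%:num) * b) <=
    t%:num * - cos a + (1 - t%:num) * - cos b by lra.
apply: H.
- move=> x /andP[ax xb]; rewrite D derive_val; apply: cos_ge0_pihalf.
  by rewrite !(le_trans _ (ltW ax), le_trans (ltW xb))//; lra.
- by apply: cvg_at_left_filter; exact: cN.
- by apply: cvg_at_right_filter; exact: cN.
- by move=> x _; exact: ex_derive.
- by rewrite D => x _; exact: ex_derive.
Qed.

Lemma ler_cos (R : realType) : {in `[0, pi] &, {mono @cos R : x y /~ y <= x}}.
Proof. by move=> x y x0 y0; rewrite !leNgt ltr_cos. Qed.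

Lemma acos_lepihalf (R : realType) (x : R) : 0 <= x <= 1 -> acos x <= pi / 2.
Proof.
move=> /andP[x0 x1]; have xN1 : -1 <= x <= 1 by rewrite x1 andbT; lra.
have pi0 := pi_gt0 R; rewrite -ler_cos ?acosK ?cos_pihalf//.
- by rewrite in_itv/= acos_ge0// acos_lepi.
- by rewrite in_itv/=; lra.
Qed.

(** The inverse of a decreasing concave function is concave: [cos] reverses the order on [[0, pi]],
    which reduces the claim to [cos_concave] at [acos r] and [acos s]. Arguments in [[0, 1]] keep
    these angles in [[0, pi / 2]], where [cos] is concave. *)
Lemma acos_concave (R : realType) (t : {i01 R}) (r s : R) :
    0 <= r <= 1 -> 0 <= s <= 1 ->
  t%:num * acos r + (1 - t%:num) * acos s <= acos (t%:num * r + (1 - t%:num) * s).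
Proof.
have t0 : 0 <= t%:num by [].
have t1 : t%:num <= 1 by [].
have cvx01 (c x y : R) : 0 <= x <= c -> 0 <= y <= c ->
    0 <= t%:num * x + (1 - t%:num) * y <= c.
  move=> /andP[x0 xc] /andP[y0 yc]; apply/andP; split; nra.
have itvN1 (x : R) : 0 <= x <= 1 -> -1 <= x <= 1.
  by move=> /andP[x0 ->]; rewrite (le_trans _ x0)// lerN10.
have acos01 (x : R) : 0 <= x <= 1 -> 0 <= acos x <= pi / 2.
  by move=> x01; rewrite acos_lepihalf// acos_ge0// itvN1.
move=> r01 s01.
have := cos_concave t (acos01 _ r01) (acos01 _ s01).
rewrite !acosK ?in_itv/= ?itvN1// => /le_trans H.
have := pi_gt0 R => pi0.
have /andP[u0 u1] := cvx01 _ _ _ (acos01 _ r01) (acos01 _ s01).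
rewrite -ler_cos.
- rewrite acosK; first exact: H.
  by rewrite in_itv/= itvN1// cvx01.
- by rewrite in_itv/= u0/=; lra.
- by rewrite in_itv/= acos_ge0 ?acos_lepi// itvN1// cvx01.
Qed.

(** * Overlap of two arcs under the uniform law *)

Lemma uniform_probE (R : realType) (a b : R) (ab : a < b) (A : set R) :
    measurable A ->
  uniform_prob ab A = ((b - a)^-1%:E * lebesgue_measure (A `&` `[a, b]))%E.
Proof.
move=> mA; rewrite /uniform_prob integral_uniform_pdf.
rewrite (eq_integral (fun=> (b - a)^-1%:E)) => [|x].
  by rewrite integral_cst//; exact: measurableI.
by rewrite inE/= in_itv/= /uniform_pdf => -[_ ->].
Qed.

(** The arc centred at [pi] is cut at [pi] into [[- pi, - pi + a]] and [[pi - a, pi]]. The arc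
    centred at [pi + al], that is at [- pi + al] modulo [2 pi], meets the first piece from
    [- pi + al - a] on, and the second only if it wraps around, from [pi + al - a] on. *)
Lemma two_arcsE (R : realType) (a al : R) :
    0 <= a <= pi / 2 -> 0 <= al <= pi / 2 ->
  [set th : R | cos th <= - cos a /\ cos (th - al) <= - cos a] `&` `[- pi, pi] =
  `[- pi + Num.max 0 (al - a), - pi + a] `|` `[pi - a + al, pi].
Proof.
have pi0 := pi_gt0 R.
move=> /andP[a0 a1] /andP[al0 al1].
have cosNE : - cos a = cos (pi - a).
  by rewrite addrC cosDpi cosN.
have le_maxE (x : R) : (- pi + Num.max 0 (al - a) <= x) =
    (0 <= x + pi) && (al - a <= x + pi).
  by rewrite -ge_max addrC lerBlDr.
(* For [th < 0] the angle [th - al] lies outside [[0, pi]]; shifting by [pi] and taking the absolute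
   value brings it back to where [cos] is monotone. *)
have cosBE th : cos (th - al) = - cos `|th - al + pi|.
  by rewrite cos_norm cosDpi opprK.
apply/seteqP; split => th /=; rewrite !in_itv/= le_maxE.
- move=> [[]] + + /andP[thN thp].
  have [th0|th0] := leP 0 th.
    rewrite cosNE ler_cos ?in_itv/=; [|lra..] => h1.
    by rewrite ler_cos ?in_itv/=; [|lra..] => h2; right; lra.
  rewrite cosBE lerN2 cosNE -(cosN th) ler_cos ?in_itv/=; [|lra..] => h1.
  rewrite ler_cos ?in_itv/= ?normr_ge0 ?ler_norml/=; [|lra..].
  by move=> h2; left; lra.
- move=> [/andP[/andP[h1 h2] h3]|/andP[h1 h2]].
    split; last by lra.
    rewrite cosBE lerN2 cosNE -(cosN th).
    by split; rewrite ler_cos ?in_itv/= ?normr_ge0 ?ler_norml/=; lra.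
  split; last by lra.
  by split; rewrite cosNE ler_cos ?in_itv/=; lra.
Qed.

Lemma measurable_sublevel d (T : measurableType d) (R : realType) (f : T -> R)
    (x : R) :
  measurable_fun [set: T] f -> measurable [set z | f z <= x].
Proof.
move=> mf; rewrite (_ : mkset _ = [set: T] `&` f @^-1` `]-oo, x]).
  by apply: mf => //; exact: measurable_itv.
by rewrite setTI; apply/seteqP; split => z /=; rewrite in_itv.
Qed.

Lemma uniform_two_arcs (R : realType) (a al : R) :
    0 <= a <= pi / 2 -> 0 <= al <= pi / 2 ->
  uniform_prob (ltNpipi R)
    [set th : R | cos th <= - cos a /\ cos (th - al) <= - cos a] =
  ((pi *+ 2)^-1 * Num.max 0 (a *+ 2 - al))%:E.
Proof.
move=> a01 al01; rewrite uniform_probE; last first.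
  have mcos b : measurable [set th : R | cos (th - b) <= - cos a].
    apply: measurable_sublevel; apply: continuous_measurable_fun => th.
    apply: continuous_comp; last exact: continuous_cos.
    by apply: cvgB; [exact: cvg_id|exact: cvg_cst].
  apply: measurableI; last exact: mcos.
  by have := mcos 0; under eq_set do rewrite subr0.
have pi0 := pi_gt0 R.
rewrite two_arcsE// measureU//=; last first.
  apply/seteqP; split => // th /=.
  rewrite !in_itv/= => -[/andP[_ h1] /andP[h2 _]].
  by move: a01 al01 => /andP[? ?] /andP[? ?]; lra.
rewrite !lebesgue_measure_itv/= !lte_fin.
move: a01 al01 => /andP[a0 a1] /andP[al0 al1].
rewrite opprK -mulr2n EFinM; congr (_ * _)%E.
(* If [al <= a] the pieces have lengths [a] and [a - al]. Otherwise the right piece is empty and the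
   left one has length [2 a - al], or is empty as well. *)
have [h1|h1] := leP al a.
  rewrite (max_l (_ : al - a <= 0)) ?(max_r (_ : 0 <= a *+ 2 - al)); [|lra..].
  by do 2 case: ifPn => [?|/negP ?]; rewrite -?EFinD ?adde0 ?add0e; congr EFin; lra.
rewrite (max_r (_ : 0 <= al - a)); last lra.
rewrite [X in (_ + X)%E]ifF; last by apply/negbTE; lra.
rewrite adde0; case: ifPn => [?|/negP ?].
  by rewrite max_r -?EFinD; [congr EFin|]; lra.
by rewrite max_l//; lra.
Qed.

(* The conditional probability of [X <= x /\ Y <= x] given [Rad = r]. *)
Definition arcs_overlap (R : realType) (x rho r : R) : R :=
  if - x <= r then (pi *+ 2)^-1 * Num.max 0 (acos (- x / r) *+ 2 - acos rho)
  else 0.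

Lemma arcs_overlapE (R : realType) (x rho r : R) :
    x <= 0 -> 0 <= rho <= 1 -> 0 < r ->
  uniform_prob (ltNpipi R)
    [set th : R | r * cos th <= x /\
      rho * (r * cos th) + Num.sqrt (1 - rho ^+ 2) * (r * sin th) <= x] =
  (arcs_overlap x rho r)%:E.
Proof.
move=> x0 /[dup] rho01 /andP[rho0 rho1] r0; rewrite /arcs_overlap.
have rhoN1 : -1 <= rho <= 1 by rewrite rho1 andbT; lra.
have divxE (y : R) : (r * y <= x) = (y <= - (- x / r)).
  by rewrite mulNr opprK ler_pdivlMr// mulrC.
have YE th : rho * (r * cos th) + Num.sqrt (1 - rho ^+ 2) * (r * sin th) =
    r * cos (th - acos rho).
  rewrite cosB acosK ?in_itv//= sin_acos//; ring.
under eq_set do rewrite YE !divxE.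
case: ifPn => [xr|]; last first.
  rewrite -ltNge => rx; rewrite (_ : mkset _ = set0) ?measure0//.
  apply/seteqP; split => // th /= [].
  have : 1 < - x / r by rewrite ltr_pdivlMr// mul1r.
  by have := cos_geN1 th; lra.
have c01 : 0 <= - x / r <= 1.
  by rewrite ler_pdivrMr// mul1r xr andbT divr_ge0 ?oppr_ge0// ltW.
have cN1 : -1 <= - x / r <= 1 by move: c01 => /andP[? ?]; apply/andP; split; lra.
rewrite -[in LHS](acosK (_ : - x / r \in `[(-1), 1])); last by rewrite in_itv.
by rewrite uniform_two_arcs// acos_lepihalf// acos_ge0.
Qed.

(** The branch depends on [x] and [r] only. Inside it, [- acos] is convex, and adding a constant,
    taking the maximum with 0 and scaling by a nonnegative factor preserve convexity. *)
Lemma arcs_overlap_convex (R : realType) (t : {i01 R}) (x rho1 rho2 r : R) :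
    0 <= rho1 <= 1 -> 0 <= rho2 <= 1 ->
  arcs_overlap x (t%:num * rho1 + (1 - t%:num) * rho2) r <=
  t%:num * arcs_overlap x rho1 r + (1 - t%:num) * arcs_overlap x rho2 r.
Proof.
move=> h1 h2; rewrite /arcs_overlap; case: ifP => [_|]; last by rewrite !mulr0 addr0.
have t0 : 0 <= t%:num by [].
have t1 : 0 <= 1 - t%:num by rewrite subr_ge0.
rewrite ![_ * (_^-1 * _)]mulrCA -mulrDr ler_wpM2l//.
  by rewrite invr_ge0 mulrn_wge0// pi_ge0.
rewrite ge_max addr_ge0 ?mulr_ge0 ?le_max ?lexx//=.
apply: (@le_trans _ _ (t%:num * (acos (- x / r) *+ 2 - acos rho1) +
    (1 - t%:num) * (acos (- x / r) *+ 2 - acos rho2))).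
  by have := acos_concave t h1 h2; lra.
by rewrite lerD// ler_wpM2l// le_max lexx orbT.
Qed.

(** * Integration over the radius *)

Section orthant.
Context d (T : measurableType d) (R : realType) (P : probability T R).
Variables Rad Theta : {RV P >-> R}.
Hypothesis Rad_gt0 : {ae P, forall w, 0 < Rad w}.
Hypothesis Rad_Theta_indep : independent_RV Rad Theta.
Hypothesis Theta_unif : uniform_angle Theta.

(** By independence the joint law agrees with the product of the marginals on rectangles, hence on
    all measurable sets, and the product measure is the integral of the measures of sections. *)
Lemma joint_lawE (A : set (R * R)) : measurable A ->
  P ((fun w => (Rad w, Theta w)) @^-1` A) =
  (\int[distribution P Rad]_r uniform_prob (ltNpipi R) (xsection A r))%E.
Proof.
move=> mA.
have mRT : measurable_fun [set: T] (fun w => (Rad w, Theta w)).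
  exact: measurable_fun_pair.
pose RT : {mfun T >-> (R * R)%type} := HB.pack (fun w => (Rad w, Theta w))
  (isMeasurableFun.Build _ _ _ _ _ mRT).
have := @product_measure_unique _ _ _ _ _ (distribution P Rad)
  (distribution P Theta) (distribution P RT).
move=> /(_ _ A mA) H.
transitivity (distribution P RT A) => //.
rewrite -H; last by move=> X Y mX mY; rewrite -Rad_Theta_indep.
apply: eq_integral => r _ /=; rewrite -Theta_unif//.
exact: measurable_xsection.
Qed.

Definition orthant (x rho : R) : set T :=
  [set w | S1 Rad Theta w <= x /\ ellY Rad Theta rho w <= x].

(** With [J] the set where [ellF] is at most [u], this is the event whose probability is the copula
    at [(u, u)]. *)
Definition diagonal (J : set R) (rho : R) : set T :=
  [set w | J (S1 Rad Theta w) /\ J (ellY Rad Theta rho w)].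

Lemma measurable_orthant x rho : measurable (orthant x rho).
Proof.
have mS1 := measurable_S1 Rad Theta.
apply: measurableI; apply: measurable_sublevel => //.
apply: measurable_funD; apply: measurable_funM => //.
apply: measurable_funM => //; apply: measurableT_comp => //.
by apply: continuous_measurable_fun; exact: continuous_sin.
Qed.

Lemma orthant_convex (x : R) (t : {i01 R}) (rho1 rho2 : R) :
    x <= 0 -> 0 <= rho1 <= 1 -> 0 <= rho2 <= 1 ->
  fine (P (orthant x (t%:num * rho1 + (1 - t%:num) * rho2))) <=
  t%:num * fine (P (orthant x rho1)) + (1 - t%:num) * fine (P (orthant x rho2)).
Proof.
move=> x0 h1 h2.
(* The orthant event in the coordinates [(Rad, Theta)]. *)
pose A rho := [set z : R * R | z.1 * cos z.2 <= x /\
  rho * (z.1 * cos z.2) + Num.sqrt (1 - rho ^+ 2) * (z.1 * sin z.2) <= x].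
have mA rho : measurable (A rho).
  have mcos : measurable_fun [set: R * R] (fun z : R * R => z.1 * cos z.2).
    apply: measurable_funM => //; apply: measurableT_comp => //.
    by apply: continuous_measurable_fun; exact: continuous_cos.
  apply: measurableI; apply: measurable_sublevel => //.
  apply: measurable_funD; apply: measurable_funM => //.
  apply: measurable_funM => //; apply: measurableT_comp => //.
  by apply: continuous_measurable_fun; exact: continuous_sin.
pose phi rho r := uniform_prob (ltNpipi R) (xsection (A rho) r).
have mphi rho : measurable_fun setT (phi rho).
  exact: (@measurable_fun_xsection _ _ _ _ R (uniform_prob (ltNpipi R)) _ (mA rho)).
have PE rho : P (orthant x rho) = (\int[distribution P Rad]_r phi rho r)%E.
  by rewrite /phi -joint_lawE.
have phiE rho r : 0 <= rho <= 1 -> 0 < r -> phi rho r = (arcs_overlap x rho r)%:E.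
  move=> rho01 r0; rewrite -arcs_overlapE// /phi; congr uniform_prob.
  by apply/seteqP; split => th; rewrite /xsection/= inE.
have t0 : 0 <= t%:num by [].
have t1 : 0 <= 1 - t%:num by rewrite subr_ge0.
have h3 : 0 <= t%:num * rho1 + (1 - t%:num) * rho2 <= 1.
  by move: h1 h2 => /andP[? ?] /andP[? ?]; apply/andP; split; nra.
rewrite -lee_fin EFinD !EFinM !fineK ?fin_num_measure//; try exact: measurable_orthant.
rewrite !PE -!ge0_integralZl_EFin// -ge0_integralD//; try exact: measurable_funeM;
  try by move=> r _; rewrite mule_ge0// lee_fin.
apply: ae_ge0_le_integral => //.
- by move=> r _; rewrite adde_ge0// mule_ge0// lee_fin.
- by apply: emeasurable_funD; exact: measurable_funeM.
(* The integrands are compared for [r > 0] only; the law of [Rad] gives no mass to the other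
   radii. *)
- exists `]-oo, 0]%classic; split; first exact: measurable_itv.
    case: Rad_gt0 => N [mN PN0 RN]; apply/eqP; rewrite eq_le measure_ge0 andbT.
    rewrite -PN0; apply: (@le_measure _ _ _ P); rewrite ?inE//.
      by rewrite -[X in measurable X]setTI; apply: (measurable_funPT Rad) => //; exact: measurable_itv.
    move=> w /=; rewrite in_itv/= => w0; apply: RN => /=.
    by apply/negP; rewrite -leNgt.
  move=> r /= rN; rewrite in_itv/= leNgt; apply/negP => r0; apply: rN => _.
  rewrite !phiE// -!EFinM -EFinD lee_fin; exact: arcs_overlap_convex.
Qed.

(** * Position of the median *)

(** The event [cos Theta <= 0] has probability 1/2 and almost surely forces [S1 <= 0]. Strictness
    comes from a disjoint event of positive probability on which [S1 <= z]: a radius at most [M]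
    together with [0 < cos Theta <= z / M]. *)
Lemma ellF_gt_half (z : R) : 0 < z -> 1 / 2 < ellF Rad Theta z.
Proof.
move=> z0; have pi0 := pi_gt0 R.
have mRadP A : measurable A -> measurable (Rad @^-1` A).
  by move=> mA; rewrite -[X in measurable X]setTI; exact: (measurable_funPT Rad).
have mThP A : measurable A -> measurable (Theta @^-1` A).
  by move=> mA; rewrite -[X in measurable X]setTI; exact: (measurable_funPT Theta).
have [M zM PM] : exists2 M, z <= M & (0 < P (Rad @^-1` `]-oo, M]))%E.
  have : nbhs (1%:E : \bar R) [set y | (0 < y)%E].
    by apply: open_nbhs_nbhs; split; [exact: open_ereal_gt_ereal|rewrite /= lte_fin].
  (* The limit controls only points strictly above [M], hence [M + 1]; the maximum with [z] makes
     [z / M] at most 1, so that it is a cosine. *)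
  move=> /(cvg_cdfy1 Rad)[M [_ HM]]; exists (Num.max z (M + 1)).
    by rewrite le_max lexx.
  by apply: (HM (Num.max z (M + 1))); rewrite lt_max ltrDl ltr01 orbT.
have M0 : 0 < M by exact: lt_le_trans zM.
have e0 : 0 < z / M by rewrite divr_gt0.
have e1 : z / M <= 1 by rewrite ler_pdivrMr// mul1r.
have eN1 : -1 <= z / M <= 1 by rewrite e1 andbT; lra.
pose b := acos (z / M).
have cosb : cos b = z / M by rewrite acosK// in_itv.
have b0 : 0 <= b by exact: acos_ge0.
have b1 : b < pi / 2.
  rewrite -ltr_cos ?in_itv/= ?b0 ?acos_lepi//; last by lra.
  by rewrite cosb cos_pihalf.
pose A0 := [set th : R | cos th <= 0].
(* The right end is left out because [cos] vanishes there, which would break disjointness from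
   [A0]. *)
pose B := `[b, pi / 2[%classic : set R.
have mA0 : measurable A0.
  by apply: measurable_sublevel; apply: continuous_measurable_fun; exact: continuous_cos.
have mB : measurable B by exact: measurable_itv.
have cosB th : B th -> 0 < cos th <= z / M.
  rewrite /B/= in_itv/= => /andP[h1 h2].
  rewrite cos_gt0_pihalf/= -?cosb ?ler_cos ?in_itv/=; lra.
have PA0 : P (Theta @^-1` A0) = (1 / 2)%:E.
  transitivity (uniform_prob (ltNpipi R) A0); first by rewrite -Theta_unif.
  (* The half circle is a pair of coinciding arcs: [a = pi / 2] and [al = 0]. *)
  rewrite (_ : A0 = [set th : R | cos th <= - cos (pi / 2) /\
      cos (th - 0) <= - cos (pi / 2)]); last first.
    by apply/seteqP; split => th /=; rewrite cos_pihalf oppr0 addr0 // => -[].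
  rewrite uniform_two_arcs ?lexx/=; [|lra..].
  by congr EFin; rewrite max_r; [field|]; lra.
have PB : (0 < P (Theta @^-1` B))%E.
  rewrite (_ : P _ = uniform_prob (ltNpipi R) B); last by rewrite -Theta_unif.
  rewrite uniform_probE// setIidl.
    rewrite lebesgue_measure_itv/= lte_fin b1 -EFinD -EFinM lte_fin.
    by rewrite mulr_gt0// ?invr_gt0; lra.
  by move=> th; rewrite /B/= !in_itv/= => /andP[? ?]; apply/andP; split; lra.
case: Rad_gt0 => N [mN PN0 RN].
pose E := Theta @^-1` A0 `|` (Rad @^-1` `]-oo, M] `&` Theta @^-1` B).
pose S := [set w | S1 Rad Theta w <= z].
have mS : measurable S.
  by apply: measurable_sublevel; exact: measurable_S1.
have mE2 : measurable (Rad @^-1` `]-oo, M] `&` Theta @^-1` B).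
  by apply: measurableI; [apply: mRadP; exact: measurable_itv|exact: mThP].
have mE : measurable E by apply: measurableU => //; exact: mThP.
have sub : E `<=` S `|` N.
  move=> w Ew; have [r0|r0] := ltP 0 (Rad w); last first.
    by right; apply: RN => /=; apply/negP; rewrite -leNgt.
  left; rewrite /S /= /S1; case: Ew => [/= h|/= []].
    by rewrite (le_trans _ (ltW z0))// mulr_ge0_le0// ltW.
  rewrite in_itv/= => rM /cosB/andP[c0 c1].
  rewrite (le_trans (ler_pM (ltW r0) (ltW c0) rM c1))//.
  by rewrite mulrC divfK// gt_eqF.
have PE : (P E <= P S)%E.
  rewrite -[leRHS]adde0 -PN0; apply: le_trans (measureU2 _ mS mN).
  by apply: le_measure; rewrite ?inE//; exact: measurableU.
rewrite /ellF -lte_fin fineK; last by apply: fin_num_measure; exact: measurable_itv.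
rewrite (_ : cdf _ _ = P S); last first.
  by congr (P _); apply/seteqP; split => w /=; rewrite in_itv.
apply: lt_le_trans PE.
have -> : P E = ((1 / 2)%:E + P (Rad @^-1` `]-oo, M]) * P (Theta @^-1` B))%E.
  rewrite -PA0 -(Rad_Theta_indep (measurable_itv _) mB).
  apply: measureU => //; first exact: mThP.
  apply/seteqP; split => // w /= [] h [_] /cosB/andP[+ _].
  by rewrite ltNge h.
by rewrite lteDl// mule_gt0.
Qed.

(* If J is open at sup J <= 0, it is exhausted by closed half-lines; this avoids
   proving that F is continuous. *)
Lemma lower_set_convex (J : set R) (t : {i01 R}) (rho1 rho2 : R) :
    (forall y z, y <= z -> J z -> J y) -> ubound J 0 ->
    0 <= rho1 <= 1 -> 0 <= rho2 <= 1 ->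
  fine (P (diagonal J (t%:num * rho1 + (1 - t%:num) * rho2))) <=
  t%:num * fine (P (diagonal J rho1)) + (1 - t%:num) * fine (P (diagonal J rho2)).
Proof.
move=> Jdown J0 h1 h2.
have [JE|/set0P J_neq0] := eqVneq J set0.
  have DE rho : diagonal J rho = set0.
    by apply/seteqP; split => // w []; rewrite JE.
  by rewrite !DE measure0/= !mulr0 addr0.
have supJ : has_sup J by split => //; exists 0.
have s0 : sup J <= 0 by exact: ge_sup.
have ltJ y : y < sup J -> J y.
  move=> ys; have /(sup_adherent (E := J))/(_ supJ)[z Jz] : 0 < sup J - y.
    by rewrite subr_gt0.
  by rewrite subKr => /ltW /Jdown; exact.
have leJ y : J y -> y <= sup J by move=> Jy; apply: ub_le_sup => //; exists 0.
(* If the supremum is attained, [J] is a closed half-line and the diagonal event is itself an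
   orthant. *)
have [Js|Js] := pselect (J (sup J)).
  have DE rho : diagonal J rho = orthant (sup J) rho.
    by apply/seteqP; split => w [hX hY]; split; rewrite ?leJ//;
      apply: Jdown Js.
  by rewrite !DE; exact: orthant_convex.
have JE y : J y <-> y < sup J.
  split=> [Jy|/ltJ//]; rewrite lt_neqAle leJ// andbT.
  by apply/eqP => ys; apply: Js; rewrite -ys.
pose x n : R := sup J - n.+1%:R^-1.
(* Continuity of [P] from below along the increasing orthants; the convexity inequality then passes
   to the limit. *)
have cvgDiag rho : fine (P (orthant (x n) rho)) @[n --> \oo] --> fine (P (diagonal J rho)).
  have DE : diagonal J rho = \bigcup_n orthant (x n) rho.
    apply/seteqP; split => w.
      move=> [/JE hX /JE hY].
      have /ltr_add_invr[k] : Num.max (S1 Rad Theta w) (ellY Rad Theta rho w) < sup J.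
        by rewrite gt_max hX.
      rewrite -ltrBrDr gt_max => /andP[/ltW ? /ltW ?].
      by exists k.
    move=> [k _ [hX hY]]; split; apply/JE.
      by apply: le_lt_trans hX _; rewrite /x ltrBlDr ltrDl invr_gt0.
    by apply: le_lt_trans hY _; rewrite /x ltrBlDr ltrDl invr_gt0.
  have mO n := measurable_orthant (x n) rho.
  have mU : measurable (\bigcup_n orthant (x n) rho) by exact: bigcup_measurable.
  apply: fine_cvg; rewrite DE fineK ?fin_num_measure//.
  apply: nondecreasing_cvg_mu => // m n mn; apply/subsetPset => w [hX hY].
  have xmn : x m <= x n.
    by rewrite /x lerB// lef_pV2 ?posrE// ler_nat ltnS.
  by split; [exact: le_trans hX xmn|exact: le_trans hY xmn].
apply: (ler_cvg_to (cvgDiag _) (cvgD (cvgM (cvg_cst _) (cvgDiag rho1))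
  (cvgM (cvg_cst _) (cvgDiag rho2)))).
apply: nearW => n; apply: orthant_convex => //.
by rewrite /x (le_trans _ s0)// lerBlDr lerDl invr_ge0.
Qed.

End orthant.

(** * Convexity of the tail dependence coefficient *)

Theorem proposition1 (R : realType) (d : measure_display)
    (T : measurableType d) (P : probability T R)
    (Rad Theta : {RV P >-> R})
    (Rad_gt0 : {ae P, forall w, 0 < Rad w})
    (Rad_Theta_indep : independent_RV Rad Theta)
    (Theta_unif : uniform_angle Theta)
    (u : R) (u_gt0 : 0 < u) (u_le_half : u <= 1 / 2) :
  convex_function (`[0, 1]%classic : set R^o)
    (fun rho : R => penultimate_tail_dependence Rad Theta rho u).
Proof.
move=> t rho1 rho2; rewrite !inE/= !in_itv/= => h1 h2.
pose J := [set z | ellF Rad Theta z <= u].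
have Jdown y z : y <= z -> J z -> J y.
  move=> yz; apply: le_trans; rewrite /ellF fine_le ?fin_num_measure//;
    by [exact: cdf_nondecreasing|exact: measurable_itv].
(* This is where [u <= 1 / 2] enters: a positive [z] has [ellF] above 1/2. *)
have J0 : ubound J 0.
  move=> z Jz; rewrite leNgt; apply/negP => z0.
  have := ellF_gt_half Rad_gt0 Rad_Theta_indep Theta_unif z0.
  by move: Jz; rewrite /J/=; lra.
have := lower_set_convex Rad_gt0 Rad_Theta_indep Theta_unif t Jdown J0 h1 h2.
rewrite /conv/= /penultimate_tail_dependence /elliptical_copula => H.
have ui0 : 0 <= u^-1 by rewrite invr_ge0 ltW.
apply: le_trans (ler_wpM2l ui0 H) _.
by rewrite mulrDr !(mulrCA u^-1).
Qed.
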